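(* Let $\mathbf B$ be an $n\times q$ random matrix with i.i.d. $\mathcal N(0,1)$ entries, $\mathbf C$ a deterministic $q\times p$ matrix, and $\mathbf A=\mathbf B\mathbf C$. Let $\mathcal K\subset\mathbb R^p$ be a compact, origin-symmetric convex set with non-empty interior, and let $\varepsilon\ge0$. For $\mathbf x^\star\in\mathcal K$, suppose we observe $\mathbf y=\mathbf A\mathbf x^\star+\boldsymbol\nu$ with $\frac1n\|\boldsymbol\nu\|_1\le\varepsilon$, and choose $\widehat{\mathbf x}$ to be a solution of $$\min\|\mathbf x\|_{\mathcal K}\ \text{ subject to }\ \tfrac1n\|\mathbf A\mathbf x-\mathbf y\|_1\le\varepsilon.$$ Then $$\mathbb E\sup_{\mathbf x^\star\in\mathcal K}\left\{(\widehat{\mathbf x}-\mathbf x^\star)^T\mathbf C^T\mathbf C(\widehat{\mathbf x}-\mathbf x^\star)\right\}^{1/2}\le\sqrt{2\pi}\left(\frac{\mathbb E\sup_{\mathbf u\in\mathcal K-\mathcal K}|\langle\mathbf C^T\mathbf g,\mathbf u\rangle|}{\sqrt n}+\varepsilon\right),$$ where $\mathbf g\sim\mathcal N(0,\mathbf I_q)$ and $\mathcal K-\mathcal K=\{\mathbf u-\mathbf v:\mathbf u,\mathbf v\in\mathcal K\}$.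
   Context: The Minkowski functional of $\mathcal K$ is $\|\mathbf x\|_{\mathcal K}=\inf\{\lambda>0:\lambda^{-1}\mathbf x\in\mathcal K\}$; under the stated assumptions on $\mathcal K$ it is a norm and $\mathbf x\in\mathcal K$ iff $\|\mathbf x\|_{\mathcal K}\le1$. No assumption is made on $\boldsymbol\nu$ other than $\frac1n\|\boldsymbol\nu\|_1\le\varepsilon$. *)

(* Defs.v *)
From HB Require Import structures.
From mathcomp Require Import all_boot all_order all_algebra.
From mathcomp Require Import all_classical all_reals all_analysis measurable_realfun.
Set Implicit Arguments. Unset Strict Implicit. Unset Printing Implicit Defensive.
Import Order.TTheory GRing.Theory Num.Theory.
Import numFieldNormedType.Exports.
Local Open Scope classical_set_scope.
Local Open Scope ring_scope.

Definition mink_functional {R : realType} {p : nat} (K : set 'cV[R]_p) (x : 'cV[R]_p) : R :=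
  inf [set l : R | 0 < l /\ K (l^-1 *: x)].

Definition l1norm {R : realType} {n : nat} (v : 'cV[R]_n) : R :=
  \sum_(i < n) `|v i 0|.

Definition dotv {R : realType} {p : nat} (u v : 'cV[R]_p) : R := (u^T *m v) 0 0.

Definition setDiff {R : realType} {p : nat} (K : set 'cV[R]_p) : set 'cV[R]_p :=
  [set u - v | u in K & v in K].

Definition iid_std_gaussian {d} {T : measurableType d} {R : realType}
    (P : probability T R) {I : finType} (X : I -> T -> R) : Prop :=
  [/\ (forall k, measurable_fun setT (X k)),
      (forall k (S : set R), measurable S ->
          P (X k @^-1` S) = normal_prob 0 1 S) &
      (forall S : I -> set R, (forall k, measurable (S k)) ->
          P (\bigcap_(k in [set: I]) (X k @^-1` S k)) =
          (\prod_(k : I) P (X k @^-1` S k))%E) ].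

(* Outer (upper) expectation: infimum of expectations of measurable
   majorants. Coincides with the expectation for measurable nonnegative f. *)
Definition upper_expectation {d} {T : measurableType d} {R : realType}
    (P : probability T R) (f : T -> \bar R) : \bar R :=
  ereal_inf [set (\int[P]_w h w)%E | h in
     [set h : T -> \bar R | measurable_fun [set: T] h /\ (forall w, (f w <= h w)%E)]].

(* Main.v *)
(* Feasibility of x^star forces xhat into K, so u = xhat - x^star lies in K - K
   and ||A u||_1 / n <= 2 eps. It remains to bound, uniformly over v in C(K - K),
   the deviation sqrt(2/pi) |v| - n^-1 sum_i |<b_i, v>|, where sqrt(2/pi) |v| is
   the mean of |<b_i, v>|. Rows are treated one at a time: if M(phi) is the
   positive part of max phi over a finite set, then for frozen values h of the
   other rows, subadditivity gives
     M(h + m - |b|) <= (M(h + 2 m) + M(h - 2 |b|)) / 2,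
   Jensen gives M(h + 2 m) <= E M(h + 2 |b|), and the contraction inequality
     M(h + 2 |b|) + M(h - 2 |b|) <= M(h + 2 b) + M(h - 2 b)
   with the symmetry of b yields E M(h + m - |b|) <= E M(h + 2 b). Replacing all
   rows, the sum of the b_i has the law of sqrt n g, whence the bound
   2 sqrt n E M(<g, .>). Finite nets of K suffice, because outer expectation is
   bounded by any measurable majorant and the net error is Lipschitz in B. *)
Require Import Defs.
From HB Require Import structures.
From mathcomp Require Import all_boot all_order all_algebra.
From mathcomp Require Import all_classical all_reals all_analysis measurable_realfun.
From mathcomp Require Import ring lra.
Import Order.TTheory GRing.Theory Num.Theory.
Import numFieldNormedType.Exports.
Local Open Scope classical_set_scope.
Local Open Scope ring_scope.
Set Implicit Arguments. Unset Strict Implicit. Unset Printing Implicit Defensive.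

(** * One-dimensional Gaussian integrals *)

Section gaussian1d.
Context {R : realType}.
Local Notation mu := (@lebesgue_measure R).
Local Notation gam := (normal_prob (0 : R) 1).
Implicit Types (f : R -> \bar R).
(** The push-forward of Lebesgue measure under [x |-> a * x + c], scaled by [a], gives every
    half-open interval its length; uniqueness of Lebesgue measure does the rest. *)
Lemma lebesgue_measure_affine (a c : R) (A : set R) : 0 < a -> measurable A ->
  mu A = (a%:E * mu ((fun x : R => (a * x + c)%R) @^-1` A))%E.
Proof.
move=> a0 mA.
pose phi x : measurableTypeR R := a * x + c.
have mphi : measurable_fun setT (phi : measurableTypeR R -> measurableTypeR R).
  exact: measurable_funD.
pose m1 := measure_function_pushforward__canonical__measure_function_Measure mu mphi.
pose m2 : {measure set (measurableTypeR R) -> \bar R} := mscale (NngNum (ltW a0)) m1.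
apply: (@lebesgue_measure_unique R m2) => // _ [[x y]] _ <-.
rewrite -[RHS]/(a%:E * mu (phi @^-1` [set` `]x, y]]))%E.
have -> : phi @^-1` [set` `]x, y]] = [set` `](x - c) / a, (y - c) / a] ].
  apply/seteqP; split=> z /=; rewrite !in_itv/= ltr_pdivrMr// ler_pdivlMr//
   ltrBlDr lerBrDr mulrC//.
rewrite !lebesgue_measure_itv/= !lte_fin ltr_pM2r ?invr_gt0// ltrD2r.
case: ifPn => _; last by rewrite mule0.
rewrite -!EFinD -EFinM; congr EFin; field; by rewrite gt_eqF.
Qed.

Lemma ge0_integral_affine (a c : R) f : 0 < a -> measurable_fun setT f ->
  (forall x, 0 <= f x)%E ->
  (\int[mu]_x f x = a%:E * \int[mu]_x f (a * x + c)%R)%E.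
Proof.
move=> a0 mf f0.
pose phi x : measurableTypeR R := a * x + c.
have mphi : measurable_fun setT (phi : measurableTypeR R -> measurableTypeR R).
  exact: measurable_funD.
pose m1 := measure_function_pushforward__canonical__measure_function_Measure mu mphi.
pose m2 : {measure set (measurableTypeR R) -> \bar R} := mscale (NngNum (ltW a0)) m1.
transitivity (\int[m2]_x f x)%E.
  apply: eq_measure_integral => A mA _.
  exact: (lebesgue_measure_affine c a0 mA).
rewrite /m2 ge0_integral_mscale//=; congr (_ * _)%E.
by rewrite ge0_integral_pushforward.
Qed.

(** The Radon-Nikodym derivative of the Gaussian law has the same integral as the density on every
    measurable set, hence equals it almost everywhere. *)
Lemma ge0_integral_normal_prob f : measurable_fun setT f ->
  (forall x, 0 <= f x)%E ->
  (\int[gam]_x f x = \int[mu]_x (f x * (normal_pdf 0 1 x)%:E))%E.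
Proof.
move=> mf f0.
have dom := normal_prob_dominates (0 : R) 1.
have fint := Radon_Nikodym_SigmaFinite.f_integrable dom.
rewrite -(Radon_Nikodym_SigmaFinite.change_of_variables dom)//.
have mpdf : measurable_fun setT (fun x : R => (normal_pdf 0 1 x)%:E).
  by apply/measurable_EFinP; exact: measurable_normal_pdf.
apply: ae_eq_integral => //.
- by apply: emeasurable_funM => //; apply: (measurable_int mu).
- by apply: emeasurable_funM.
- apply: ae_eqe_mul2l => /=.
  apply: integral_ae_eq => // E _ mE.
  exact: esym (Radon_Nikodym_SigmaFinite.f_integral dom mE).
Qed.

Lemma std_normal_pdfE (x : R) :
  normal_pdf 0 1 x = normal_peak 1 * expR (- x ^+ 2 / 2).
Proof.
by rewrite normal_pdfE ?oner_eq0// /normal_fun subr0 expr1n.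
Qed.

(** Stability of the Gaussian law under independent sums. Substituting [u = a * x + b * y] in the
    inner integral (hence [0 < b]) and exchanging the integrals leaves, for each [u], a Gaussian
    integral in [x] computed by completing the square. *)
Lemma normal_prob_conv (a b : R) f : 0 < b -> measurable_fun setT f ->
  (forall x, 0 <= f x)%E ->
  (\int[gam]_x \int[gam]_y f (a * x + b * y)%R =
   \int[gam]_z f (Num.sqrt (a ^+ 2 + b ^+ 2) * z)%R)%E.
Proof.
move=> b0 mf f0; set s := Num.sqrt _.
have ss : s ^+ 2 = a ^+ 2 + b ^+ 2 by rewrite sqr_sqrtr// addr_ge0// sqr_ge0.
have s0 : 0 < s by rewrite sqrtr_gt0 ltr_wpDl// ?sqr_ge0// exprn_gt0.
pose phi : R -> R := normal_pdf 0 1.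
have phi0 x : 0 <= phi x by exact: normal_pdf_ge0.
have mphi : measurable_fun setT phi by exact: measurable_normal_pdf.
have inner u : (\int[mu]_x (b^-1 * phi ((u - a * x) / b) * phi x)%:E = (phi (u / s) / s)%:E)%E.
  (* Shift that completes the square: the total exponent becomes that of [u / s] plus that of
     [s / b * x + k]. *)
  pose k := - a * u / (s * b).
  have e x : b^-1 * phi ((u - a * x) / b) * phi x = (phi (u / s) / b) * phi (s / b * x + k).
    rewrite /phi !std_normal_pdfE.
    transitivity (normal_peak 1 * normal_peak 1 / b * (expR (- ((u - a * x) / b) ^+ 2 / 2) * expR
        (- x ^+ 2 / 2))).
      by ring.
    transitivity (normal_peak 1 * normal_peak 1 / b * (expR (- (u / s) ^+ 2 / 2) * expR (- (s / b
        * x + k) ^+ 2 / 2))); last by ring.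
    rewrite -!expRD; congr (_ * expR _).
    (* Clearing denominators turns the equality of exponents into a polynomial identity modulo
       [s ^+ 2 = a ^+ 2 + b ^+ 2]. *)
    apply: (@mulIf _ (2 * s ^+ 2 * b ^+ 2)); first by rewrite !mulf_neq0// ?expf_neq0// gt_eqF.
    rewrite [LHS](_ : _ = - (u - a * x) ^+ 2 * s ^+ 2 - x ^+ 2 * b ^+ 2 * s ^+ 2); last first.
      by field; rewrite gt_eqF.
    rewrite [RHS](_ : _ = - u ^+ 2 * b ^+ 2 - (s ^+ 2 * x - a * u) ^+ 2); last first.
      by rewrite /k; field; rewrite !gt_eqF.
    by rewrite ss; ring.
  under eq_integral do rewrite e EFinM.
  rewrite ge0_integralZl//=; last 3 first.
  - apply/measurable_EFinP; apply: (measurableT_comp mphi) => //.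
    exact: measurable_funD.
  - by move=> x _; rewrite lee_fin.
  - by rewrite lee_fin divr_ge0// ltW.
  have sb0 : 0 < s / b by rewrite divr_gt0.
  (* The density has total mass one, so the integral of [phi (s / b * x + k)] is [b / s]. *)
  have := @ge0_integral_affine (s / b) k (fun x => (phi x)%:E) sb0.
  rewrite integral_normal_pdf => /(_ _ _)H.
  rewrite [X in (_ * X)%E](_ : _ = (b / s)%:E).
    by rewrite -EFinM; congr EFin; field; rewrite !gt_eqF.
  have -> : (b / s)%:E = ((b / s)%:E * 1)%E by rewrite mule1.
  rewrite H//; last first.
    exact/measurable_EFinP.
  rewrite muleA -EFinM (_ : b / s * (s / b) = 1) ?mul1e//.
  by field; rewrite !gt_eqF.
have mphiE : measurable_fun setT (fun y : R => (phi y)%:E) by exact/measurable_EFinP.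
have mff (x : R) : measurable_fun setT (fun y => f (a * x + b * y)%R).
  by apply: (measurableT_comp mf); exact: measurable_funD.
have m1 : measurable_fun setT (fun z : R * R => (f (z.2) * (b^-1 * phi ((z.2 - a * z.1) / b) *
    phi z.1)%:E)%E).
  apply: emeasurable_funM; first exact: measurableT_comp.
  apply/measurable_EFinP; apply: measurable_funM; last exact: measurableT_comp.
  apply: measurable_funM => //; apply: (measurableT_comp mphi).
  apply: measurable_funM => //; apply: measurable_funB => //.
  by apply: measurable_funM.
have m1_ge0 (z : R * R) : (0 <= f (z.2) * (b^-1 * phi ((z.2 - a * z.1) / b) * phi z.1)%:E)%E.
  by apply: mule_ge0 => //; rewrite lee_fin !mulr_ge0// invr_ge0 ltW.
have step1 (x : R) : (\int[gam]_y f (a * x + b * y)%R * (phi x)%:E = \int[mu]_u (f u * (b^-1 *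
    phi ((u - a * x) / b) * phi x)%:E))%E.
  rewrite ge0_integral_normal_prob//.
  rewrite (@ge0_integral_affine b (a * x) (fun u => (f u * (b^-1 * phi ((u - a * x) / b) * phi
      x)%:E)%E))//; last 2 first.
  - exact: (measurableT_comp m1 (pair1_measurable x)).
  - by move=> u; exact: (m1_ge0 (x, u)).
  rewrite -ge0_integralZr//=; last 3 first.
  - exact: (emeasurable_funM (mff x) mphiE).
  - by move=> y _; rewrite mule_ge0// lee_fin.
  - by rewrite lee_fin.
  rewrite -ge0_integralZl//=; last 3 first.
  - apply: (measurableT_comp (measurableT_comp m1 (pair1_measurable x))).
    exact: measurable_funD.
  - by move=> y _; exact: (m1_ge0 (x, _)).
  - by rewrite lee_fin ltW.
  apply: eq_integral => y _.
  rewrite addrK [b * y]mulrC mulfK ?gt_eqF// [y * b + _]addrC [y * b]mulrC.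
  rewrite -[in LHS]muleA -EFinM [RHS]muleCA -EFinM; congr (_ * _%:E)%E.
  by rewrite /phi mulrA mulrA divff ?gt_eqF// mul1r.
rewrite ge0_integral_normal_prob//=; last 2 first.
- have H : measurable_fun setT (fun z : R * R => f (a * z.1 + b * z.2)%R).
    apply: (measurableT_comp mf); apply: measurable_funD => //;
    exact: measurable_funM.
  exact: (@measurable_fun_fubini_tonelli_F _ _ _ _ _ gam _ H).
- by move=> x; exact: integral_ge0.
under eq_integral do rewrite step1.
rewrite (@fubini_tonelli _ _ _ _ _ mu mu _ m1 m1_ge0)/=.
rewrite ge0_integral_normal_prob//=; last first.
  exact: (measurableT_comp mf).
transitivity (\int[mu]_u (f u * (phi (u / s) / s)%:E))%E.
  apply: eq_integral => u _; rewrite ge0_integralZl//= ?inner//.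
  - apply/measurable_EFinP; apply: measurable_funM => //.
    apply: measurable_funM => //; apply: (measurableT_comp mphi).
    by apply: measurable_funM => //; apply: measurable_funB => //; exact: measurable_funM.
  - by move=> x _; rewrite lee_fin !mulr_ge0// invr_ge0 ltW.
have m2 : measurable_fun setT (fun u : R => f u * (phi (u / s) / s)%:E)%E.
  apply: emeasurable_funM => //; apply/measurable_EFinP; apply: measurable_funM => //.
  exact: (measurableT_comp mphi (mulrr_measurable s^-1)).
have m2_ge0 (x : R) : (0 <= f x * (phi (x / s) / s)%:E)%E.
  by rewrite mule_ge0// lee_fin divr_ge0// ltW.
rewrite (ge0_integral_affine 0 s0 m2 m2_ge0).
rewrite -ge0_integralZl//=; last 2 first.
- apply: (measurableT_comp m2); exact: measurable_funD.
- by rewrite lee_fin ltW.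
apply: eq_integral => x _.
rewrite addr0 [s * x]mulrC mulfK ?gt_eqF// muleCA -EFinM; congr (_ * _%:E)%E.
by rewrite /phi mulrCA divff ?gt_eqF// mulr1.
Qed.

Lemma normal_prob_opp (S : set R) : measurable S ->
  gam (-%R @^-1` S) = gam S.
Proof.
move=> mS.
rewrite /normal_prob.
have mm : measurable_fun setT (fun x : R => (normal_pdf 0 1 x)%:E).
  by apply/measurable_EFinP; exact: measurable_normal_pdf.
rewrite (@eq_integral _ _ _ mu _ (fun x => (normal_pdf 0 1 (- x))%:E)); last first.
  by move=> x _; rewrite !std_normal_pdfE sqrrN.
have mopp : measurable_fun setT (-%R : measurableTypeR R -> measurableTypeR R) by exact:
    oppr_measurable.
rewrite -(@ge0_integral_pushforward _ _ _ _ _ _ mopp mu S (fun x => (normal_pdf 0 1 x)%:E))//;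
    last 2 first.
- exact: measurable_funTS.
- by move=> x _; rewrite lee_fin normal_pdf_ge0.
apply: eq_measure_integral => A mA _; exact: lebesgue_measureN.
Qed.

(** The integrand has the primitive [- normal_peak 1 * expR (- x ^+ 2 / 2)], which vanishes at
    infinity. *)
Lemma integral0y_id_normal_pdf :
  (\int[mu]_(x in `[0%R, +oo[) (x * normal_pdf 0 1 x)%:E = (normal_peak 1)%:E)%E.
Proof.
pose F (x : R) := - normal_peak 1 * expR (- x ^+ 2 / 2).
have dF (x : R) : is_derive x 1 F (x * normal_pdf 0 1 x).
  rewrite /F std_normal_pdfE; apply: is_derive_eq.
  by rewrite !scaler0 /GRing.scale/=; field.
have cF : continuous F.
  by move=> x; apply: differentiable_continuous; apply/derivable1_diffP; case: (dF x).
have -> : (normal_peak 1)%:E = (0%:E - (F 0)%:E)%E :> \bar R.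
  by rewrite /F expr0n/= oppr0 mul0r expR0 mulr1 -EFinB opprK add0r.
apply: ge0_continuous_FTC2y.
- by move=> x x0; rewrite mulr_ge0// normal_pdf_ge0.
- apply: continuous_subspaceT => x; apply: continuousM; first exact: cvg_id.
  by apply: continuous_normal_pdf; rewrite oner_eq0.
- rewrite -(mulr0 (- normal_peak 1)); apply: cvgM; first exact: cvg_cst.
  under eq_fun do rewrite mulNr.
  apply: (cvg_comp (fun x : R => x ^+ 2 / 2) (fun x => expR (- x))); last exact: cvgr_expR.
  by apply: gt0_cvgMly => //; exact: cvgr_expr2.
- by move=> x _; case: (dF x).
- apply: cvg_at_right_filter; exact: cF.
- by move=> x _; rewrite derive1E; exact: derive_val.
Qed.

(** The value is the square root of [2 / pi]: by parity each half-line contributes [normal_peak 1],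
    the inverse square root of [2 * pi]. *)
Lemma normal_prob_abs_moment :
  (\int[gam]_x `|x|%:E = (2 / Num.sqrt (2 * pi))%:E)%E.
Proof.
have mabs : measurable_fun setT (fun x : R => `|x|%:E * (normal_pdf 0 1 x)%:E)%E.
  by apply: emeasurable_funM; apply/measurable_EFinP => //; exact: measurable_normal_pdf.
rewrite ge0_integral_normal_prob//; last exact/measurable_EFinP.
have abs_ge0 x : (0 <= `|x|%:E * (normal_pdf (0:R) 1 x)%:E)%E.
  by rewrite mule_ge0// lee_fin normal_pdf_ge0.
rewrite -{1}(setvU `[0%R, +oo[%classic) ge0_integral_setU//=; last 3 first.
- exact: measurableC.
- by rewrite setvU.
- by rewrite disj_set2E setICl.
have pos : (\int[mu]_(x in `[0%R, +oo[) (`|x|%:E * (normal_pdf (0:R) 1 x)%:E) = (normal_peak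
    1)%:E)%E.
  rewrite -integral0y_id_normal_pdf; apply: eq_integral => x.
  by rewrite inE/= in_itv/= andbT => x0; rewrite ger0_norm// EFinM.
rewrite pos.
have -> : (2 / Num.sqrt (2 * pi))%:E = ((normal_peak 1)%:E + (normal_peak 1)%:E)%E :> \bar R.
  have -> : normal_peak 1 = (Num.sqrt (2 * pi))^-1 :> R.
    by rewrite /normal_peak expr1n mul1r -mulr_natl.
  by rewrite -EFinD mulr_natl mulr2n.
congr (_ + _)%E.
rewrite -pos ge0_integration_by_substitution0// setCitvr.
rewrite -integral_itv_bndo_bndc; last first.
  apply: measurable_funTS; apply: (measurableT_comp mabs); exact: oppr_measurable.
apply: eq_integral => x _.
by rewrite normrN !std_normal_pdfE sqrrN.
Qed.
End gaussian1d.

(** * Laws of families of independent Gaussians *)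

Section random_vectors.
Context {R : realType}.

(** A pi-system generating the product sigma-algebra on [I -> R]; the independence clause of
    [iid_std_gaussian] speaks exactly of preimages of boxes. *)
Definition boxes (I : finType) : set (set (I -> R)) :=
  [set A | exists2 S : I -> set R, (forall k, measurable (S k)) &
     A = [set x | forall k, S k (x k)]].

Definition rvec (I : finType) := g_sigma_algebraType (@boxes I).

Lemma boxes_setI (I : finType) : setI_closed (@boxes I).
Proof.
move=> _ _ [S mS ->] [S' mS' ->]; exists (fun k => S k `&` S' k).
  by move=> k; exact: measurableI.
apply/seteqP; split=> x /=; first by move=> [h h'] k; split.
by move=> h; split=> k; case: (h k).
Qed.

Lemma measurable_coord (I : finType) (i : I) :
  measurable_fun setT (fun x : rvec I => x i).
Proof.
move=> _ Y mY; rewrite setTI; apply: sub_sigma_algebra.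
exists (fun k => if k == i then Y else setT).
  by move=> k; case: ifP.
apply/seteqP; split=> x /=; first by move=> Yx k; case: eqP => // ->.
by move=> /(_ i); rewrite eqxx.
Qed.

Lemma measurable_to_rvec (I : finType) d (T : measurableType d) (X : I -> T -> R) :
  (forall k, measurable_fun setT (X k)) ->
  measurable_fun setT (fun w => X^~ w : rvec I).
Proof.
move=> mX; apply: (@measurability _ _ T (rvec I) _ _ (@boxes I)) => //.
move=> _ [_ [S mS ->] <-].
rewrite setTI [X in measurable X](_ : _ = \bigcap_(k in [set: I]) (X k @^-1` S k)).
  by apply: fin_bigcap_measurable => // k _; rewrite -[_ @^-1` _]setTI; exact: mX.
apply/seteqP; split => w /=; first by move=> h k _; exact: h.
by move=> h k; exact: (h k Logic.I).
Qed.

(** The joint law is prescribed on boxes, a pi-system, hence everywhere. Expectations can thus be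
    moved between different probability spaces and different Gaussian families. *)
Lemma iid_integral_eq (I : finType) d (T : measurableType d) (P : probability T R)
    d' (T' : measurableType d') (P' : probability T' R)
    (X : I -> T -> R) (Y : I -> T' -> R) (F : rvec I -> \bar R) :
  iid_std_gaussian P X -> iid_std_gaussian P' Y ->
  measurable_fun setT F -> (forall x, 0 <= F x)%E ->
  (\int[P]_w F (X^~ w) = \int[P']_w F (Y^~ w))%E.
Proof.
move=> [mX lX iX] [mY lY iY] mF F0.
have mX' := measurable_to_rvec mX; have mY' := measurable_to_rvec mY.
transitivity (\int[pushforward P (fun w => X^~ w : rvec I)]_x F x)%E.
  by rewrite ge0_integral_pushforward.
transitivity (\int[pushforward P' (fun w => Y^~ w : rvec I)]_x F x)%E; last first.
  by rewrite ge0_integral_pushforward.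
apply: eq_measure_integral => A mA _.
pose m1 := measure_function_pushforward__canonical__measure_function_Measure P mX'.
pose m2 := measure_function_pushforward__canonical__measure_function_Measure P' mY'.
apply: (@measure_unique _ R (rvec I) (@boxes I) (fun=> setT) _ _ _ _ m1 m2) => //.
- exact: boxes_setI.
- by move=> _; exists (fun=> setT) => //; apply/seteqP; split.
- by rewrite bigcup_const//; exists 0%N.
- move=> _ [S mS ->].
  transitivity (P (\bigcap_(k in [set: I]) (X k @^-1` S k))).
    congr (P _); apply/seteqP; split => w /=; first by move=> h k _; exact: h.
    by move=> h k; exact: (h k Logic.I).
  transitivity (P' (\bigcap_(k in [set: I]) (Y k @^-1` S k))); last first.
    congr (P' _); apply/seteqP; split => w /=; last by move=> h k _; exact: h.
    by move=> h k; exact: (h k Logic.I).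
  rewrite iX// iY//; apply: eq_bigr => k _; by rewrite lX// lY.
- by move=> _; rewrite /m1 /= /pushforward preimage_setT probability_setT ltry.
Qed.

(** Coordinates may be drawn from two independent sources: the preimage of a box is a rectangle,
    each side constraining only the coordinates taken from that source. *)
Lemma iid_prod (I : finType) d (T : measurableType d) (P : probability T R)
    d' (T' : measurableType d') (P' : probability T' R)
    (X : I -> T -> R) (Y : I -> T' -> R) (D : pred I) :
  iid_std_gaussian P X -> iid_std_gaussian P' Y ->
  iid_std_gaussian (P \x P')%E (fun i z => if D i then X i z.1 else Y i z.2).
Proof.
move=> [mX lX iX] [mY lY iY].
have e i (S : set R) : [set z : T * T' | S (if D i then X i z.1 else Y i z.2)] =
   (if D i then X i @^-1` S else setT) `*` (if D i then setT else Y i @^-1` S).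
  by apply/seteqP; split=> -[x y]; case: (D i) => /=; tauto.
have mXS i S : measurable S -> measurable (X i @^-1` S).
  by move=> mS; rewrite -[_ @^-1` _]setTI; exact: mX.
have mYS i S : measurable S -> measurable (Y i @^-1` S).
  by move=> mS; rewrite -[_ @^-1` _]setTI; exact: mY.
have mX1 i S : measurable S -> measurable (if D i then X i @^-1` S else setT).
  by move=> mS; case: ifP => // _; exact: mXS.
have mY1 i S : measurable S -> measurable (if D i then setT else Y i @^-1` S).
  by move=> mS; case: ifP => // _; exact: mYS.
have law i (S : set R) : measurable S ->
  (P \x P')%E ((fun z : T * T' => if D i then X i z.1 else Y i z.2) @^-1` S) = normal_prob 0 1 S.
  move=> mS; rewrite -[_ @^-1` _]/[set z : T * T' | S (if D i then X i z.1 else Y i z.2)] e.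
  rewrite product_measure1E; [|exact: mX1|exact: mY1].
  by case: (D i) => /=; rewrite probability_setT ?mule1 ?mul1e ?lX ?lY.
split => //.
- move=> k; case: (D k).
    by apply: (measurableT_comp (mX k)).
  by apply: (measurableT_comp (mY k)).
- move=> S mS.
  transitivity ((P \x P')%E ((\bigcap_(k in [set: I]) (X k @^-1` (if D k then S k else setT))) `*`
        (\bigcap_(k in [set: I]) (Y k @^-1` (if D k then setT else S k))))).
    congr ((P \x P')%E _); apply/seteqP; split.
      by move=> [x y] h; split => k _; have := h k Logic.I => /=; case: (D k).
    by move=> [x y] [/= h h'] k _; have := h k Logic.I; have := h' k Logic.I => /=; case: (D k).
  have mS1 k : measurable (if D k then S k else setT) by case: (D k).
  have mS2 k : measurable (if D k then setT else S k) by case: (D k).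
  rewrite product_measure1E; last 2 first.
  - by apply: fin_bigcap_measurable => // k _; exact: mXS.
  - by apply: fin_bigcap_measurable => // k _; exact: mYS.
  transitivity ((\prod_k P (X k @^-1` (if D k then S k else setT))) *
      (\prod_k P' (Y k @^-1` (if D k then setT else S k))))%E.
    congr (_ * _)%E; first exact: (iX (fun k => if D k then S k else setT)).
    exact: (iY (fun k => if D k then setT else S k)).
  rewrite -big_split/=; apply: eq_bigr => k _.
  rewrite law// lX// lY//.
  by case: (D k) => /=; rewrite probability_setT ?mule1 ?mul1e.
Qed.

(** The form in which independence is used below: the coordinates in [D] are frozen in the outer
    integral while the others are resampled in the inner one. *)
Lemma iid_tonelli (I : finType) d (T : measurableType d) (P : probability T R)
    (X : I -> T -> R) (D : pred I) (F : rvec I -> \bar R) :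
  iid_std_gaussian P X -> measurable_fun setT F -> (forall x, 0 <= F x)%E ->
  (\int[P]_w F (X^~ w) =
   \int[P]_w \int[P]_w' F (fun i => if D i then X i w else X i w'))%E.
Proof.
move=> iX mF F0; have iX2 := iid_prod D iX iX.
rewrite (iid_integral_eq iX iX2 mF F0).
rewrite fubini_tonelli1//=.
apply: (measurableT_comp mF); apply: (measurable_to_rvec (X := fun i z => _)).
by case: iX2.
Qed.

Lemma measurable_tonelli_fun d (T : measurableType d) d' (T' : measurableType d')
   (P : probability T' R) (F : T -> T' -> \bar R) :
   measurable_fun setT (fun z => F z.1 z.2) -> (forall x y, 0 <= F x y)%E ->
  measurable_fun setT (fun x => \int[P]_y F x y)%E.
Proof.
move=> mF F0.
exact: (@measurable_fun_fubini_tonelli_F _ _ _ _ _ P (fun z => F z.1 z.2) mF).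
Qed.

Lemma iid_reindex (I J : finType) (h : J -> I) d (T : measurableType d) (P : probability T R)
    (X : I -> T -> R) : injective h ->
  iid_std_gaussian P X -> iid_std_gaussian P (X \o h).
Proof.
move=> hi [mX lX iX]; split; [by move=> k; exact: mX|by move=> k S; exact: lX|].
(* A box over [J] is extended to [I] by full sides off the range of [h]; these contribute factors
   equal to 1. *)
move=> S mS; pose S' i := if [pick j | h j == i] is Some j then S j else setT.
have S'h j : S' (h j) = S j.
  rewrite /S'; case: pickP => [j' /eqP/hi ->//|/(_ j)]; by rewrite eqxx.
have S'n i : i \notin codom h -> S' i = setT.
  move=> hn; rewrite /S'; case: pickP => [j /eqP ji|//]; move: hn.
  by rewrite -ji codom_f.
have mS' i : measurable (S' i) by rewrite /S'; case: pickP.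
have := iX _ mS'.
rewrite (_ : \bigcap_(k in _) _ = \bigcap_(j in [set: J]) ((X \o h) j @^-1` S j)); last first.
  apply/seteqP; split => w /= H k _; first by rewrite -S'h; exact: (H (h k)).
  have [/codomP[j ->]|kn] := boolP (k \in codom h); first by rewrite S'h; exact: (H j).
  by rewrite S'n.
move=> ->; rewrite (bigID (mem (codom h)))/= [X in (_ * X)%E]big1 ?mule1; last first.
  by move=> i ni; rewrite S'n// preimage_setT probability_setT.
rewrite (reindex_omap h (fun i => [pick j | h j == i])) => [|i ih]; last first.
  case: pickP => [j /eqP <-//|hn]; case/codomP: ih => j ij.
  by have := hn j; rewrite -ij eqxx.
apply: eq_big => [j|j _]; last by rewrite S'h.
rewrite codom_f; case: pickP => [j' /eqP/hi ->|/(_ j)]; by rewrite eqxx.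
Qed.

Lemma iid_opp (I : finType) d (T : measurableType d) (P : probability T R) (X : I -> T -> R) :
  iid_std_gaussian P X -> iid_std_gaussian P (fun i w => - X i w).
Proof.
move=> [mX lX iX].
have mN (S : set R) : measurable S -> measurable (-%R @^-1` S).
  by move=> mS; rewrite -[_ @^-1` _]setTI; exact: oppr_measurable.
split; first by move=> k; exact: measurable_funN.
  by move=> k S mS; rewrite -(normal_prob_opp mS) -(lX k)//; exact: mN.
by move=> S mS; rewrite -(iX (fun k => -%R @^-1` S k))// => k; exact: mN.
Qed.

Lemma iid_integral1 (I : finType) d (T : measurableType d) (P : probability T R) (X : I -> T -> R)
  (i : I) (f : R -> \bar R) :
  iid_std_gaussian P X -> measurable_fun setT f -> (forall x, 0 <= f x)%E ->
  (\int[P]_w f (X i w) = \int[normal_prob (0:R) 1]_x f x)%E.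
Proof.
move=> [mX lX _] mf f0.
have mXi : measurable_fun setT (X i : T -> measurableTypeR R) by exact: mX.
transitivity (\int[pushforward P (X i : T -> measurableTypeR R)]_x f x)%E.
  by rewrite (ge0_integral_pushforward mXi).
by apply: eq_measure_integral => A mA _; exact: lX.
Qed.

End random_vectors.

(** * Linear combinations and normalized column sums of independent Gaussians *)

Section gaussian_sums.
Context {R : realType}.
Local Notation gam := (normal_prob (0 : R) 1).

Lemma measurable_lincomb (I : finType) (r : seq I) (c : I -> R) :
  measurable_fun setT (fun x : rvec I => \sum_(j <- r) c j * x j).
Proof.
apply: measurable_sum => j; apply: measurable_funM => //.
exact: measurable_coord.
Qed.

(** Induction on [r] for all [f] at once: with [X j] frozen, its contribution is a shift absorbed
    into [f], the tail is a scaled Gaussian, and [normal_prob_conv] merges the two. *)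
Lemma iid_lincomb (J : finType) d (T : measurableType d) (P : probability T R)
    (X : J -> T -> R) (c : J -> R) (r : seq J) (f : R -> \bar R) :
  iid_std_gaussian P X -> uniq r ->
  measurable_fun setT f -> (forall x, 0 <= f x)%E ->
  (\int[P]_w f (\sum_(j <- r) c j * X j w)%R =
   \int[gam]_x f (Num.sqrt (\sum_(j <- r) c j ^+ 2) * x)%R)%E.
Proof.
move=> iX; elim: r f => [|j r IH] f /= => [_|/andP[jr ur]] mf f0.
  under eq_integral do rewrite big_nil.
  rewrite integral_cst//= probability_setT mule1.
  under eq_integral do rewrite big_nil sqrtr0 mul0r.
  by rewrite integral_cst//= probability_setT mule1.
pose s := Num.sqrt (\sum_(j <- r) c j ^+ 2).
have s0 : 0 <= s by exact: sqrtr_ge0.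
have ss : s ^+ 2 = \sum_(j <- r) c j ^+ 2.
  by rewrite sqr_sqrtr// sumr_ge0// => i _; exact: sqr_ge0.
transitivity (\int[P]_w \int[P]_w' f (c j * X j w + \sum_(i <- r) c i * X i w')%R)%E.
  have mF : measurable_fun setT (fun x : rvec J => f (\sum_(i <- j :: r) c i * x i)).
    exact: (measurableT_comp mf (measurable_lincomb _ _)).
  rewrite (iid_tonelli (pred1 j) iX mF)//.
  apply: eq_integral => w _; apply: eq_integral => w' _; congr f.
  rewrite big_cons /= eqxx; congr (_ + _).
  rewrite !big_seq; apply: eq_bigr => i ir; case: eqP => // ij.
  by rewrite -ij ir in jr.
have mfx x : measurable_fun setT (fun y => f (c j * x + y)).
  by apply: (measurableT_comp mf); exact: measurable_funD.
under eq_integral => w _ do rewrite (IH (fun y => f (c j * X j w + y)))//.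
rewrite -/s.
have mG : measurable_fun setT (fun x => \int[gam]_y f (c j * x + s * y)%R)%E.
  apply: (@measurable_tonelli_fun R _ _ _ _ gam (fun x y : R => f (c j * x + s * y))) => //.
  apply: (measurableT_comp mf); apply: measurable_funD; exact: measurable_funM.
rewrite (iid_integral1 j iX mG); last by move=> x; exact: integral_ge0.
(* [normal_prob_conv] requires a positive second coefficient. When the tail has variance zero only
   [c j * x] remains, and the sign of [c j] is removed by symmetry of the Gaussian. *)
move: s0; rewrite le_eqVlt => /predU1P[s0|s0]; last first.
  rewrite normal_prob_conv// ; apply: eq_integral => x _.
  by rewrite big_cons ss.
rewrite big_cons -ss -s0 expr0n addr0 sqrtr_sqr.
under eq_integral do under eq_integral do rewrite mul0r addr0.
under eq_integral do rewrite integral_cst//= probability_setT mule1.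
have [c0|c0] := leP 0 (c j); first by rewrite ger0_norm.
rewrite ltr0_norm//.
have mfc : measurable_fun setT (fun x => f (c j * x)).
  exact: (measurableT_comp mf).
rewrite -(iid_integral1 j (iid_opp iX) mfc)//.
have mfc' : measurable_fun setT (fun x => f (- c j * x)).
  exact: (measurableT_comp mf).
rewrite -(iid_integral1 j iX mfc')//.
by apply: eq_integral => w _; rewrite mulrN mulNr.
Qed.

Lemma probability_integral d (T : measurableType d) (P : probability T R) (A : set T) :
  measurable A -> P A = (\int[P]_w (\1_A w)%:E)%E.
Proof. by move=> mA; rewrite integral_indic// setIT. Qed.

Definition scaled_colsum (I J : finType) (x : I * J -> R) (j : J) : R :=
  (\sum_(i : I) x (i, j)) / Num.sqrt #|I|%:R.

Lemma measurable_scaled_colsum (I J : finType) d (T : measurableType d) (X : I * J -> T -> R) j :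
  (forall k, measurable_fun setT (X k)) ->
  measurable_fun setT (fun w => scaled_colsum (X^~ w) j).
Proof.
by move=> mX; apply: measurable_funM => //; apply: measurable_sum => i; exact: mX.
Qed.

Lemma scaled_colsum_law (I J : finType) d (T : measurableType d) (P : probability T R)
    (X : I * J -> T -> R) (j : J) (S : set R) : (0 < #|I|)%N -> iid_std_gaussian P X ->
  measurable S ->
  P ((fun w => scaled_colsum (X^~ w) j) @^-1` S) = gam S.
Proof.
move=> I0 iX mS.
have mX : forall k, measurable_fun setT (X k) by case: iX.
have mSp : measurable ((fun w => scaled_colsum (X^~ w) j) @^-1` S).
  by rewrite -[_ @^-1` _]setTI; exact: measurable_scaled_colsum.
have iXj : iid_std_gaussian P (X \o (fun i : I => (i, j))).
  by apply: iid_reindex => // i i' [].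
have m1 : measurable_fun setT (fun x : R => (\1_S x : R)%:E).
  by apply/measurable_EFinP; exact: measurable_indic.
have := iid_lincomb (fun=> (Num.sqrt #|I|%:R)^-1) iXj (index_enum_uniq I) m1.
(* The normalization makes the squared coefficients sum to 1, so the variance stays 1. *)
have n1 : Num.sqrt (\sum_(i : I) ((Num.sqrt #|I|%:R : R)^-1) ^+ 2) = 1.
  rewrite sumr_const exprVn sqr_sqrtr ?ler0n// -[X in Num.sqrt X]mulr_natr mulVf ?sqrtr1//.
  by rewrite pnatr_eq0 -lt0n.
rewrite n1 => H.
transitivity (\int[P]_w (\1_S (\sum_(i : I) (Num.sqrt #|I|%:R)^-1 * X (i, j) w) : R)%:E)%E.
  rewrite (probability_integral _ mSp).
  apply: eq_integral => w _; rewrite /indic /scaled_colsum -mulr_sumr mulrC.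
  by congr (_%:R%:E).
rewrite H; last by move=> x; rewrite lee_fin.
under eq_integral do rewrite mul1r.
by rewrite integral_indic// setIT.
Qed.

(** Different columns use disjoint sets of entries. The probability of a box is the mean of a
    product of indicators, from which [iid_tonelli] splits off one column at a time. *)
Lemma iid_scaled_colsum (I J : finType) d (T : measurableType d) (P : probability T R)
    (X : I * J -> T -> R) : (0 < #|I|)%N -> iid_std_gaussian P X ->
  iid_std_gaussian P (fun j w => scaled_colsum (X^~ w) j).
Proof.
move=> I0 iX; have mX : forall k, measurable_fun setT (X k) by case: iX.
have mZ := measurable_scaled_colsum _ mX.
split=> [j//|j S mS|S mS]; first exact: scaled_colsum_law.
have mind d2 (T2 : measurableType d2) (Y : I * J -> T2 -> R) r :
    (forall k, measurable_fun setT (Y k)) ->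
    measurable_fun setT (fun w => (\prod_(j <- r) (\1_(S j) (scaled_colsum (Y^~ w) j) : R))%R).
  move=> mY; apply: measurable_prod => j _.
  apply: (measurableT_comp (measurable_indic (mS j))).
  exact: measurable_scaled_colsum.
have ind_ge0 (x : rvec (I * J)%type) r : 0 <= \prod_(j <- r) (\1_(S j) (scaled_colsum x j) : R).
  by apply: prodr_ge0.
have main r : uniq r ->
  (\int[P]_w (\prod_(j <- r) (\1_(S j) (scaled_colsum (X^~ w) j) : R))%:E =
   \prod_(j <- r) P ((fun w => scaled_colsum (X^~ w) j) @^-1` S j))%E.
  elim: r => [_|j r IH /= /andP[jr ur]].
    under eq_integral do rewrite big_nil.
    by rewrite big_nil integral_cst//= probability_setT mule1.
  pose F (x : rvec (I * J)%type) := (\prod_(j <- j :: r) (\1_(S j) (scaled_colsum x j) : R))%:E.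
  have mF : measurable_fun setT F.
    apply/measurable_EFinP; exact: (mind _ (rvec (I * J)%type) (fun k x => x k) (j :: r)
        (@measurable_coord R _)).
  transitivity (\int[P]_w \int[P]_w' ((\1_(S j) (scaled_colsum (X^~ w) j) : R)%:E *
     (\prod_(j <- r) (\1_(S j) (scaled_colsum (X^~ w') j) : R))%:E))%E.
    rewrite (iid_tonelli (fun k => k.2 == j) iX mF); last first.
      by move=> x; rewrite lee_fin; exact: ind_ge0.
    apply: eq_integral => w _; apply: eq_integral => w' _.
    rewrite /F big_cons EFinM; congr (_%:E * _%:E)%E.
      rewrite /scaled_colsum; congr (\1_(S j) (_ / _)).
      by apply: eq_bigr => i _; rewrite eqxx.
    rewrite !big_seq; apply: eq_bigr => k kr.
    rewrite /scaled_colsum; congr (\1_(S k) (_ / _)).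
    apply: eq_bigr => i _ /=; case: eqP => // kj; by rewrite -kj kr in jr.
  have mprod := mind _ _ X r mX.
  under eq_integral => w _.
    rewrite ge0_integralZl//; last 2 first.
    - exact/measurable_EFinP.
    - by move=> w' _; rewrite lee_fin; exact: (ind_ge0 (X^~ w')).
    over.
  rewrite ge0_integralZr//; last 2 first.
  - apply/measurable_EFinP; apply: (measurableT_comp (measurable_indic (mS j))).
    exact: mZ.
  - by apply: integral_ge0 => w' _; rewrite lee_fin; exact: (ind_ge0 (X^~ w')).
  rewrite IH// big_cons; congr (_ * _)%E.
  have mSp : measurable ((fun w => scaled_colsum (X^~ w) j) @^-1` S j).
    by rewrite -[_ @^-1` _]setTI; exact: mZ.
  by rewrite (probability_integral _ mSp).
rewrite -main ?index_enum_uniq//.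
have mSp : measurable (\bigcap_(j in [set: J]) ((fun w => scaled_colsum (X^~ w) j) @^-1` S j)).
  apply: fin_bigcap_measurable => // j _.
  by rewrite -[_ @^-1` _]setTI; exact: mZ.
rewrite (probability_integral _ mSp); apply: eq_integral => w _.
congr EFin; rewrite indicE; case: (boolP (w \in _)) => [|/negP].
  rewrite inE => H; rewrite big1// => j _; rewrite indicE mem_set//; exact: (H j).
move=> H; suff [j hj] : exists j, ~ S j (scaled_colsum (X^~ w) j).
  by rewrite (bigD1 j)//= indicE memNset// mul0r.
by apply: contrapT => /forallNP H'; apply: H; rewrite inE => j _; apply: contrapT; exact: H'.
Qed.

End gaussian_sums.

(** * Symmetrization and contraction *)

Section maxpos.
Context {R : realType} {V : eqType}.
Implicit Types (s : seq V) (f g : V -> R).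

(** Starting the maximum at 0 keeps every integrand nonnegative, so that integrals are always
    defined and Tonelli applies. *)
Definition maxpos s f : R := \big[Num.max/0]_(v <- s) f v.

Lemma maxpos_nil f : maxpos [::] f = 0.
Proof. by rewrite /maxpos big_nil. Qed.

Lemma maxpos_cons v s f : maxpos (v :: s) f = Num.max (f v) (maxpos s f).
Proof. by rewrite /maxpos big_cons. Qed.

Lemma maxpos_ge0 s f : 0 <= maxpos s f.
Proof.
by elim: s => [|v s IH]; rewrite ?maxpos_nil// maxpos_cons le_max IH orbT.
Qed.

Lemma maxpos_ge s f v : v \in s -> f v <= maxpos s f.
Proof.
elim: s => // u s IH; rewrite inE maxpos_cons le_max => /predU1P[->|/IH ->].
  by rewrite lexx.
by rewrite orbT.
Qed.

Lemma maxpos_le s f c : 0 <= c -> {in s, forall v, f v <= c} -> maxpos s f <= c.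
Proof.
move=> c0; elim: s => [|u s IH] H; rewrite ?maxpos_nil// maxpos_cons ge_max.
rewrite H ?mem_head//= IH// => v vs; apply: H.
by rewrite inE vs orbT.
Qed.

(** Case analysis on where the maximum is attained, the starting value 0 included; [Q] is free, so
    it can be an inequality between extended reals. *)
Lemma maxpos_attained s f (Q : R -> Prop) :
  Q 0 -> {in s, forall v, Q (f v)} -> Q (maxpos s f).
Proof.
move=> c0; elim: s => [|u s IH] H; rewrite ?maxpos_nil// maxpos_cons.
have [_|_] := leP (f u) (maxpos s f); last by apply: H; rewrite mem_head.
by apply: IH => v vs; apply: H; rewrite inE vs orbT.
Qed.

Lemma eq_maxpos s f g : f =1 g -> maxpos s f = maxpos s g.
Proof. by move=> fg; apply: eq_bigr => v _; exact: fg. Qed.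

Lemma maxpos_mull s f (c : R) : 0 <= c -> maxpos s (fun v => c * f v) = c * maxpos s f.
Proof.
move=> c0; elim: s => [|v s IH]; first by rewrite !maxpos_nil mulr0.
by rewrite !maxpos_cons IH maxr_pMr.
Qed.

Lemma measurable_maxpos d (T : measurableType d) s (f : V -> T -> R) :
  (forall v, measurable_fun setT (f v)) ->
  measurable_fun setT (fun w => maxpos s (f^~ w)).
Proof.
move=> mf; elim: s => [|v s IH].
  rewrite [X in measurable_fun _ X](_ : _ = cst 0)//.
  by apply/funext => w; rewrite maxpos_nil.
rewrite [X in measurable_fun _ X](_ : _ = f v \max (fun w => maxpos s (f^~ w))).
  exact: measurable_maxr.
by apply/funext => w; rewrite maxpos_cons.
Qed.

(** The argument on the left is the average of the two arguments on the right. *)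
Lemma maxpos_split s (h m y : V -> R) :
  2 * maxpos s (fun v => h v + (m v - `|y v|)) <=
  maxpos s (fun v => h v + 2 * m v) + maxpos s (fun v => h v - 2 * `|y v|).
Proof.
rewrite -ler_pdivlMl// mulrC.
apply: maxpos_le => [|v vs]; first by rewrite divr_ge0// addr_ge0// maxpos_ge0.
have h1 := maxpos_ge (fun v => h v + 2 * m v) vs.
have h2 := maxpos_ge (fun v => h v - 2 * `|y v|) vs.
by rewrite ler_pdivlMr//; lra.
Qed.

(** Let [u] and [v] attain the two maxima on the left. If [y u >= 0], then [u] is a competitor for
    the maximum with [+ 2 * y] and [v] for the one with [- 2 * y], because [- |y v| <= - y v]; if
    [y u < 0] the roles are exchanged. Maxima equal to 0 are separate cases. *)
Lemma maxpos_contraction s (h y : V -> R) :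
  maxpos s (fun v => h v + 2 * `|y v|) + maxpos s (fun v => h v - 2 * `|y v|) <=
  maxpos s (fun v => h v + 2 * y v) + maxpos s (fun v => h v - 2 * y v).
Proof.
set A := maxpos s (fun v => h v + 2 * y v); set B := maxpos s (fun v => h v - 2 * y v).
have A0 : 0 <= A by exact: maxpos_ge0.
have B0 : 0 <= B by exact: maxpos_ge0.
have hA v : v \in s -> h v + 2 * y v <= A by exact: (maxpos_ge (fun v => h v + 2 * y v)).
have hB v : v \in s -> h v - 2 * y v <= B by exact: (maxpos_ge (fun v => h v - 2 * y v)).
have yN v : - y v <= `|y v| by rewrite -normrN; exact: ler_norm.
have yP v : y v <= `|y v| by exact: ler_norm.
apply: (@maxpos_attained _ _ (fun a => a + _ <= _)).
  rewrite add0r; apply: maxpos_le => [|v vs]; first by rewrite addr_ge0.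
  have := hA v vs; have := yN v; lra.
move=> u us; apply: (@maxpos_attained _ _ (fun b => _ + b <= _)).
  rewrite addr0; have := hA u us; have := hB u us.
  by have [y0|y0] := leP 0 (y u); [rewrite ger0_norm// | rewrite ltr0_norm//]; lra.
move=> v vs; have := hA u us; have := hB u us; have := hA v vs; have := hB v vs.
have := yN v; have := yP v.
by have [y0|y0] := leP 0 (y u); [rewrite (ger0_norm y0) | rewrite (ltr0_norm y0)]; lra.
Qed.

End maxpos.

(** * Symmetrization of the deviation, first for one Gaussian row and then for all rows *)

Section symmetrization.
Context {R : realType}.
Local Notation gam := (normal_prob (0 : R) 1).
Local Notation kap := (2 / Num.sqrt (2 * pi) : R).

(* No measurability: the integral of a nonnegative function is a supremum over
   the simple functions below it. *)
Lemma ge0_le_integralT d (T : measurableType d) (mu : {measure set T -> \bar R})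
    (f g : T -> \bar R) : (forall x, 0 <= f x)%E -> (forall x, f x <= g x)%E ->
  (\int[mu]_x f x <= \int[mu]_x g x)%E.
Proof.
move=> f0 fg; have g0 x : (0 <= g x)%E by exact: le_trans (fg x).
rewrite !ge0_integralTE//; apply: le_ereal_sup => _ [h hf <-]; exists h => // x.
exact: le_trans (fg x).
Qed.

Definition linform (q : nat) (v : 'cV[R]_q) (x : 'I_q -> R) : R :=
  \sum_(j < q) v j 0 * x j.

Definition norm2 (q : nat) (v : 'cV[R]_q) : R :=
  Num.sqrt (\sum_(j < q) v j 0 ^+ 2).

Lemma measurable_linform (q : nat) (v : 'cV[R]_q) d (T : measurableType d)
   (X : 'I_q -> T -> R) : (forall j, measurable_fun setT (X j)) ->
  measurable_fun setT (fun w => linform v (X^~ w)).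
Proof. by move=> mX; apply: measurable_sum => j; exact: measurable_funM. Qed.

Lemma linformN (q : nat) (v : 'cV[R]_q) (x : 'I_q -> R) :
  linform v (fun j => - x j) = - linform v x.
Proof. by rewrite /linform -sumrN; apply: eq_bigr => j _; rewrite mulrN. Qed.

Section single_vector.
Context (q : nat) d (T : measurableType d) (P : probability T R) (X : 'I_q -> T -> R).
Hypothesis iX : iid_std_gaussian P X.
Let mX : forall j, measurable_fun setT (X j). Proof. by case: iX. Qed.

(** The form is distributed as [norm2 v] times a standard Gaussian, whose mean absolute value is
    [kap]. *)
Lemma norm2_le_linform (v : 'cV[R]_q) :
  ((kap * norm2 v)%:E <= \int[P]_w `|linform v (X^~ w)|%:E)%E.
Proof.
have mabs : measurable_fun setT (fun x : R => `|x|%:E) by exact/measurable_EFinP.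
rewrite /linform (iid_lincomb (fun j => v j 0) iX (index_enum_uniq _) mabs)//.
rewrite -/(norm2 v).
under eq_integral do rewrite normrM ger0_norm ?sqrtr_ge0// EFinM.
rewrite ge0_integralZl//; last by rewrite lee_fin sqrtr_ge0.
rewrite mulrC EFinM lee_wpmul2l ?lee_fin ?sqrtr_ge0//.
by rewrite normal_prob_abs_moment.
Qed.

Lemma maxpos_jensen (s : seq 'cV[R]_q) (h : 'cV[R]_q -> R) :
  ((maxpos s (fun v => h v + 2 * (kap * norm2 v)))%:E <=
   \int[P]_w (maxpos s (fun v => h v + 2 * `|linform v (X^~ w)|))%:E)%E.
Proof.
set E := (\int[P]_w _)%E.
have mabs v : measurable_fun setT (fun w => `|linform v (X^~ w)|).
  apply: measurableT_comp => //; exact: measurable_linform.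
have mmax : measurable_fun setT (fun w => (maxpos s (fun v => h v + 2 * `|linform v (X^~
    w)|))%:E).
  apply/measurable_EFinP; apply: (@measurable_maxpos R _ d T s (fun v w => h v + 2 * `|linform v
      (X^~ w)|)) => v.
  by apply: measurable_funD => //; exact: measurable_funM.
apply: (@maxpos_attained _ _ _ _ (fun a => a%:E <= E)%E) => [|v vs]; first by apply: integral_ge0
    => w _; rewrite lee_fin maxpos_ge0.
(* Adding [c] makes the integrand nonnegative, so the integral splits; being finite, [c] is
   cancelled at the end. *)
pose c : R := `|h v|.
have hc0 : 0 <= h v + c by rewrite addrC -lerBlDr sub0r /c -normrN; exact: ler_norm.
have : (\int[P]_w ((h v + c)%:E + 2%:E * `|linform v (X^~ w)|%:E) <=
  \int[P]_w ((maxpos s (fun v => h v + 2 * `|linform v (X^~ w)|))%:E + c%:E))%E.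
  apply: ge0_le_integralT => w.
    by rewrite -EFinM -EFinD lee_fin addr_ge0// mulr_ge0.
  rewrite -EFinM -!EFinD lee_fin -addrA [c + _]addrC addrA lerD2r.
  exact: (maxpos_ge (fun v => h v + 2 * `|linform v (X^~ w)|)).
rewrite !ge0_integralD//=; last 3 first.
- by move=> w _; rewrite lee_fin maxpos_ge0.
- by move=> w _; rewrite lee_fin normr_ge0.
- by apply: measurable_funeM; exact/measurable_EFinP.
rewrite !integral_cst//= probability_setT !mule1 -/E.
rewrite ge0_integralZl//; last exact/measurable_EFinP.
move=> H; rewrite -(@leeD2rE _ c%:E)//; apply: le_trans H.
rewrite -EFinD addrAC EFinD leeD2lE// EFinM lee_wpmul2l ?lee_fin//.
exact: norm2_le_linform.
Qed.

(** After doubling: [maxpos_split], Jensen for the deterministic half, then contraction. The two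
    resulting means coincide because [X] and its opposite have the same law, which absorbs the
    factor 2. *)
Lemma symmetrize1 (s : seq 'cV[R]_q) (h : 'cV[R]_q -> R) :
  (\int[P]_w (maxpos s (fun v => h v + (kap * norm2 v - `|linform v (X^~ w)|)))%:E <=
   \int[P]_w (maxpos s (fun v => h v + 2 * linform v (X^~ w)))%:E)%E.
Proof.
have mlin v : measurable_fun setT (fun w => linform v (X^~ w)) by exact: measurable_linform.
have mabs v : measurable_fun setT (fun w => `|linform v (X^~ w)|).
  by apply: measurableT_comp.
have mmax (f : 'cV[R]_q -> T -> R) : (forall v, measurable_fun setT (f v)) ->
    measurable_fun setT (fun w => (maxpos s (f^~ w))%:E).
  by move=> mf; apply/measurable_EFinP; exact: measurable_maxpos.
have max0 (f : 'cV[R]_q -> R) : (0 <= (maxpos s f)%:E)%E by rewrite lee_fin maxpos_ge0.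
have mm v : measurable_fun setT (fun w => 2 * linform v (X^~ w)) by exact: measurable_funM.
have mma v : measurable_fun setT (fun w => 2 * `|linform v (X^~ w)|) by exact: measurable_funM.
have m1 := mmax (fun v w => h v + (kap * norm2 v - `|linform v (X^~ w)|)) (fun v =>
    measurable_funD (measurable_cst _) (measurable_funB (measurable_cst _) (mabs v))).
have m2 := mmax (fun v w => h v + 2 * `|linform v (X^~ w)|) (fun v => measurable_funD
    (measurable_cst _) (mma v)).
have m3 := mmax (fun v w => h v - 2 * `|linform v (X^~ w)|) (fun v => measurable_funB
    (measurable_cst _) (mma v)).
have m4 := mmax (fun v w => h v + 2 * linform v (X^~ w)) (fun v => measurable_funD
    (measurable_cst _) (mm v)).
have m5 := mmax (fun v w => h v - 2 * linform v (X^~ w)) (fun v => measurable_funB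
    (measurable_cst _) (mm v)).
rewrite -(@lee_pmul2l _ 2%:E)// ?lte_fin//.
rewrite -ge0_integralZl//.
apply: (@le_trans _ _ (\int[P]_w ((maxpos s (fun v => h v + 2 * (kap * norm2 v)))%:E +
    (maxpos s (fun v => h v - 2 * `|linform v (X^~ w)|))%:E))%E).
  apply: ge0_le_integralT => w; first by rewrite mule_ge0.
  by rewrite -EFinM -EFinD lee_fin maxpos_split.
rewrite ge0_integralD//= integral_cst//= probability_setT mule1.
apply: (@le_trans _ _ (\int[P]_w (maxpos s (fun v => h v + 2 * `|linform v (X^~ w)|))%:E +
    \int[P]_w (maxpos s (fun v => h v - 2 * `|linform v (X^~ w)|))%:E)%E).
  by apply: leeD2r; exact: maxpos_jensen.
rewrite -ge0_integralD//=.
apply: (@le_trans _ _ (\int[P]_w ((maxpos s (fun v => h v + 2 * linform v (X^~ w)))%:E +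
    (maxpos s (fun v => h v - 2 * linform v (X^~ w)))%:E))%E).
  apply: ge0_le_integralT => w; first by rewrite adde_ge0.
  by rewrite -!EFinD lee_fin maxpos_contraction.
rewrite ge0_integralD//=.
have -> : (\int[P]_w (maxpos s (fun v => h v - 2 * linform v (X^~ w)))%:E =
  \int[P]_w (maxpos s (fun v => h v + 2 * linform v (X^~ w)))%:E)%E.
  pose F (x : rvec 'I_q) := (maxpos s (fun v => h v + 2 * linform v x))%:E.
  have mF : measurable_fun setT F.
    apply/measurable_EFinP.
    apply: (@measurable_maxpos R _ _ (rvec 'I_q) s (fun v x => h v + 2 * linform v x)) => v.
    apply: measurable_funD => //; apply: measurable_funM => //.
    by apply: (measurable_linform v (X := fun j (x : rvec 'I_q) => x j)) => j; exact:
        measurable_coord.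
  have F0 x : (0 <= F x)%E by exact: max0.
  rewrite -[RHS]/(\int[P]_w F (X^~ w))%E (iid_integral_eq iX (iid_opp iX) mF F0).
  apply: eq_integral => w _; congr EFin; apply: eq_maxpos => v.
  by rewrite linformN mulrN.
by rewrite mule_natl mule2n.
Qed.
End single_vector.

Section rows.
Context (n q : nat) d (T : measurableType d) (P : probability T R).
Context (X : 'I_n * 'I_q -> T -> R).
Hypothesis iX : iid_std_gaussian P X.
Let mX : forall k, measurable_fun setT (X k). Proof. by case: iX. Qed.
Implicit Types (s : seq 'cV[R]_q) (r : seq 'I_n).

Definition rowform (i : 'I_n) (v : 'cV[R]_q) (x : 'I_n * 'I_q -> R) : R :=
  linform v (fun j => x (i, j)).

(* The rows in [r] have already been symmetrized. *)
Definition hybrid r (v : 'cV[R]_q) (i : 'I_n) (x : 'I_n * 'I_q -> R) : R :=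
  if i \in r then 2 * rowform i v x else kap * norm2 v - `|rowform i v x|.

Lemma measurable_hybrid r v i d2 (T2 : measurableType d2) (Y : 'I_n * 'I_q -> T2 -> R) :
  (forall k, measurable_fun setT (Y k)) ->
  measurable_fun setT (fun w => hybrid r v i (Y^~ w)).
Proof.
move=> mY; have mrow : measurable_fun setT (fun w => rowform i v (Y^~ w)).
  by apply: (measurable_linform v (X := fun j => Y (i, j))) => j; exact: mY.
rewrite /hybrid; case: (i \in r); first exact: measurable_funM.
by apply: measurable_funB => //; exact: measurableT_comp.
Qed.

Lemma measurable_maxpos_hybrid s r d2 (T2 : measurableType d2) (Y : 'I_n * 'I_q -> T2 -> R) :
  (forall k, measurable_fun setT (Y k)) ->
  measurable_fun setT (fun w => (maxpos s (fun v => \sum_(i < n) hybrid r v i (Y^~ w)))%:E).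
Proof.
move=> mY; apply/measurable_EFinP.
apply: (@measurable_maxpos R _ _ T2 s (fun v w => \sum_(i < n) hybrid r v i (Y^~ w))) => v.
by apply: measurable_sum => i; exact: measurable_hybrid.
Qed.

(** All rows but [k] are frozen in the outer integral; their terms form the function [h] of
    [symmetrize1], applied to row [k] in the inner integral. *)
Lemma symmetrize_row s r k : k \notin r ->
  (\int[P]_w (maxpos s (fun v => \sum_(i < n) hybrid r v i (X^~ w)))%:E <=
   \int[P]_w (maxpos s (fun v => \sum_(i < n) hybrid (k :: r) v i (X^~ w)))%:E)%E.
Proof.
move=> kr.
pose F r (x : rvec ('I_n * 'I_q)%type) := (maxpos s (fun v => \sum_(i < n) hybrid r v i x))%:E.
have mF r' : measurable_fun setT (F r').
  by apply: measurable_maxpos_hybrid; exact: measurable_coord.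
have F0 r' x : (0 <= F r' x)%E by rewrite lee_fin maxpos_ge0.
rewrite -[X in (X <= _)%E]/(\int[P]_w F r (X^~ w))%E -[X in (_ <= X)%E]/(\int[P]_w F (k :: r)
    (X^~ w))%E.
rewrite !(iid_tonelli (fun p => p.1 != k) iX (mF _) (F0 _)).
apply: ge0_le_integralT => w; first exact: integral_ge0.
have iXk : iid_std_gaussian P (X \o (fun j : 'I_q => (k, j))).
  by apply: iid_reindex => // j j' [].
pose h v := \sum_(i < n | i != k) hybrid r v i (X^~ w).
have rowE i v w' : rowform i v (fun p => if p.1 != k then X p w else X p w') =
   if i == k then linform v ((X \o (fun j => (k, j)))^~ w') else rowform i v (X^~ w).
  by rewrite /rowform /linform; case: eqP => [->|ik]; apply: eq_bigr => j _ /=; rewrite ?eqxx//;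
     case: eqP.
have := symmetrize1 iXk s h.
congr (_ <= _)%E; apply: eq_integral => w' _; congr EFin; apply: eq_maxpos => v.
  rewrite (bigD1 k)//= addrC; congr (_ + _).
    apply: eq_bigr => i ik; by rewrite /hybrid rowE (negbTE ik).
  by rewrite /hybrid (negbTE kr) rowE eqxx.
rewrite (bigD1 k)//= addrC; congr (_ + _).
  apply: eq_bigr => i ik; by rewrite /hybrid inE rowE (negbTE ik).
by rewrite /hybrid mem_head rowE eqxx.
Qed.

Lemma symmetrize_rows s :
  (\int[P]_w (maxpos s (fun v => \sum_(i < n) (kap * norm2 v - `|rowform i v (X^~ w)|)))%:E <=
   \int[P]_w (maxpos s (fun v => \sum_(i < n) 2 * rowform i v (X^~ w)))%:E)%E.
Proof.
have H r : uniq r ->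
   (\int[P]_w (maxpos s (fun v => \sum_(i < n) hybrid [::] v i (X^~ w)))%:E <=
    \int[P]_w (maxpos s (fun v => \sum_(i < n) hybrid r v i (X^~ w)))%:E)%E.
  elim: r => // k r IH /= /andP[kr ur]; apply: le_trans (IH ur) _.
  exact: symmetrize_row.
have := H _ (enum_uniq 'I_n).
congr (_ <= _)%E; apply: eq_integral => w' _; congr EFin; apply: eq_maxpos => v.
by apply: eq_bigr => i _; rewrite /hybrid mem_enum.
Qed.

(** The sum of the rows is [Num.sqrt n%:R] times the vector of scaled column sums, which is again
    standard Gaussian and can be exchanged for [Y]. *)
Lemma gaussian_process_bound d' (T' : measurableType d') (P' : probability T' R)
    (Y : 'I_q -> T' -> R) s : (0 < n)%N -> iid_std_gaussian P' Y ->
  (\int[P]_w (maxpos s (fun v => \sum_(i < n) (kap * norm2 v - `|rowform i v (X^~ w)|)))%:E <=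
   (2 * Num.sqrt n%:R)%:E * \int[P']_w (maxpos s (fun v => linform v (Y^~ w)))%:E)%E.
Proof.
move=> n0 iY; apply: le_trans (symmetrize_rows s) _.
have card0 : (0 < #|'I_n|)%N by rewrite card_ord.
have iZ := iid_scaled_colsum card0 iX.
have c0 : 0 <= 2 * Num.sqrt (n%:R : R) by rewrite mulr_ge0// sqrtr_ge0.
pose F (x : rvec 'I_q) := (maxpos s (fun v => linform v x))%:E.
have mF : measurable_fun setT F.
  apply/measurable_EFinP.
  apply: (@measurable_maxpos R _ _ (rvec 'I_q) s (fun v x => linform v x)) => v.
  by apply: (measurable_linform v (X := fun j (x : rvec 'I_q) => x j)) => j; exact:
      measurable_coord.
have F0 x : (0 <= F x)%E by rewrite lee_fin maxpos_ge0.
rewrite -[X in (_ * X)%E]/(\int[P']_w F (Y^~ w))%E (iid_integral_eq iY iZ mF F0).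
rewrite -ge0_integralZl//; last first.
  apply: (measurableT_comp mF).
  by apply: (measurable_to_rvec (X := fun j w => scaled_colsum (X^~ w) j)); case: iZ.
rewrite le_eqVlt; apply/predU1P; left; apply: eq_integral => w _.
rewrite -EFinM -maxpos_mull//; congr EFin; apply: eq_maxpos => v.
rewrite -mulr_sumr -mulrA; congr (_ * _).
rewrite /rowform /linform exchange_big/= mulr_sumr; apply: eq_bigr => j _.
rewrite -mulr_sumr /scaled_colsum card_ord mulrCA; congr (_ * _).
by rewrite mulrCA mulfV ?mulr1// gt_eqF// sqrtr_gt0 ltr0n.
Qed.

End rows.

End symmetrization.

(** * Convex bodies and nets *)

Section convex_body.
Context {R : realType} {p : nat} (K : set 'cV[R]_p).
Hypothesis K_compact : compact K.
Hypothesis K_symm : forall x, K x -> K (- x).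
Hypothesis K_convex : convex_set (K : set (convex_lmodType 'cV[R]_p)).
Hypothesis K_int : (interior K) !=set0.

Lemma convex_mem (t : R) (x y : 'cV[R]_p) : 0 <= t -> t <= 1 -> K x -> K y ->
  K (t *: x + (1 - t) *: y).
Proof.
move=> t0 t1 Kx Ky.
by have := K_convex (Itv01 t0 t1) (mem_set Kx) (mem_set Ky); rewrite inE.
Qed.

Lemma zero_mem : K 0.
Proof.
have [x /interior_subset Kx] := K_int.
have := convex_mem (t := 2^-1) _ _ Kx (K_symm Kx).
by rewrite scalerN -scalerBl [_ - _](_ : _ = 0) ?scale0r; [apply; lra|lra].
Qed.

Lemma star_shaped (t : R) (x : 'cV[R]_p) : 0 <= t -> t <= 1 -> K x -> K (t *: x).
Proof. by move=> t0 t1 Kx; have := convex_mem t0 t1 Kx zero_mem; rewrite scaler0 addr0. Qed.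

(** If [K] contains a ball around [x0], it contains by symmetry one around [- x0], and [z] is the
    midpoint of [x0 + z] and [z - x0]. *)
Lemma ball_mem : exists2 r : R, 0 < r & forall z : 'cV[R]_p, `|z| < r -> K z.
Proof.
have [x0] := K_int; rewrite /interior -nbhs_ballE => -[r /= r0 rK].
exists r => // z zr.
have h1 : K (x0 + z) by apply: rK; rewrite mx_norm_ball /ball_/= opprD addNKr normrN.
have h2 : K (z - x0).
  rewrite -opprB; apply: K_symm; apply: rK.
  by rewrite mx_norm_ball /ball_/= subKr.
have zE : 2^-1 *: (x0 + z) + (1 - 2^-1) *: (z - x0) = z.
  by apply/matrixP => i j; rewrite !mxE; lra.
by rewrite -zE; apply: convex_mem => //; lra.
Qed.

Lemma mink_functional_le1 (x : 'cV[R]_p) : K x -> mink_functional K x <= 1.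
Proof.
move=> Kx; apply: ge_inf; first by exists 0 => l [/ltW].
by split; rewrite ?ltr01// invr1 scale1r.
Qed.

(** A point outside the closed set [K] has a neighbourhood of radius [r] outside [K]. An admissible
    scale [l] close to the infimum is either at most 1, and [K] is star-shaped, or so close to 1
    that [l^-1 *: x] lies in that neighbourhood. *)
Lemma mem_of_mink_functional_le1 (x : 'cV[R]_p) : mink_functional K x <= 1 -> K x.
Proof.
move=> x1; apply: contrapT => nKx.
have clK : closed K by apply: compact_closed => //; exact: norm_hausdorff.
have : open (~` K) by exact: closed_openC.
rewrite openE => /(_ x nKx); rewrite /interior -nbhs_ballE => -[r /= r0 rK].
have [s s0 sK] := ball_mem.
have x10 : 0 < `|x| + 1 by rewrite ltr_pwDr.
(* An admissible scale must be exhibited, since the infimum of the empty set is 0 by default; a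
   small ball inside [K] provides one. *)
have hinf : has_inf [set l : R | 0 < l /\ K (l^-1 *: x)].
  split; last by exists 0 => l [/ltW].
  exists ((`|x| + 1) / s); split; first by rewrite divr_gt0.
  apply: sK; rewrite normrZ invf_div ger0_norm ?divr_ge0 ?(ltW x10) ?(ltW s0)//.
  by rewrite mulrAC ltr_pdivrMr// ltr_pM2l// ltrDl.
(* Chosen so that [l < 1 + r / (|x| + 1)] forces [(l - 1) * |x| < r]; the added 1 covers [x = 0]. *)
have e0 : 0 < r / (`|x| + 1) by rewrite divr_gt0.
have [l [l0 Kl] lt] := inf_adherent e0 hinf.
have {lt}lt : l < 1 + r / (`|x| + 1) by apply: lt_le_trans lt _; rewrite lerD2r.
have [l1|l1] := leP l 1.
  apply: nKx; have := star_shaped (ltW l0) l1 Kl.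
  by rewrite scalerA mulfV ?scale1r// gt_eqF.
suff : (~` K) (l^-1 *: x) by apply.
apply: rK; rewrite mx_norm_ball /ball_/=.
rewrite -{1}[x]scale1r -scalerBl normrZ ger0_norm; last by rewrite subr_ge0 invf_le1// ltW.
apply: (@le_lt_trans _ _ ((l - 1) * `|x|)).
  apply: ler_wpM2r => //.
  rewrite -(ler_pM2r l0) mulrBl mulVf ?gt_eqF// mul1r ler_peMr ?subr_ge0//; exact: ltW.
apply: (@le_lt_trans _ _ (r / (`|x| + 1) * `|x|)).
  by apply: ler_wpM2r => //; rewrite lerBlDl ltW.
by rewrite mulrAC ltr_pdivrMr// ltr_pM2l// ltrDl.
Qed.

Lemma compact_finite_net (delta : R) : 0 < delta ->
  exists2 s : seq 'cV[R]_p, {in s, forall x, K x} &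
    forall x, K x -> exists2 y, y \in s & `|x - y| < delta.
Proof.
move=> d0; have := K_compact; rewrite compact_cover.
move=> /(_ _ K (fun x => ball x delta)) [x _|x Kx|D DK KD].
- exact: ball_open.
- by exists x => //; exact: ballxx.
exists (finmap.enum_fset D) => [x /DK|x Kx]; first by rewrite inE.
have [y /= yD yx] := KD _ Kx; exists y => //.
by move: yx; rewrite mx_norm_ball /ball_/= distrC.
Qed.
End convex_body.

(** * Lipschitz estimates for the passage from a net to the whole body *)

Section lipschitz.
Context {R : realType}.

Lemma le_mx_norm (p : nat) (z : 'cV[R]_p) (i : 'I_p) : `|z i 0| <= `|z|.
Proof.
rewrite [leRHS]/Num.norm/= mx_normrE.
exact: (le_bigmax 0 (fun ij : 'I_p * 'I_1 => `|z ij.1 ij.2|) (i, 0)).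
Qed.

(** A crude bound on the operator norm from the max norm to the l1 norm, chosen because its mean for
    a Gaussian matrix is explicit. *)
Definition abs_sum (m n : nat) (C : 'M[R]_(m, n)) : R := \sum_(i < m) \sum_(j < n) `|C i j|.

Lemma abs_sum_ge0 (m n : nat) (C : 'M[R]_(m, n)) : 0 <= abs_sum C.
Proof. by apply: sumr_ge0 => i _; apply: sumr_ge0. Qed.

Lemma mulmx_l1norm_le (q p : nat) (C : 'M[R]_(q, p)) (z : 'cV[R]_p) :
  l1norm (C *m z) <= abs_sum C * `|z|.
Proof.
rewrite /l1norm /abs_sum mulr_suml; apply: ler_sum => i _.
rewrite mxE mulr_suml; apply: le_trans (ler_norm_sum _ _ _) _.
by apply: ler_sum => j _; rewrite normrM ler_wpM2l// le_mx_norm.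
Qed.

(** Squaring reduces this to coordinatewise bounds: each entry of [b] is at most [norm2 b] in
    absolute value, each entry of [z] at most [l1norm z]. *)
Lemma norm2_le_add_l1norm (q : nat) (b z : 'cV[R]_q) : norm2 (b + z) <= norm2 b + l1norm z.
Proof.
have l0 : 0 <= l1norm z by apply: sumr_ge0.
have n0 (v : 'cV[R]_q) : 0 <= norm2 v by exact: sqrtr_ge0.
have nE (v : 'cV[R]_q) : norm2 v ^+ 2 = \sum_(j < q) v j 0 ^+ 2.
  by rewrite sqr_sqrtr// sumr_ge0// => j _; exact: sqr_ge0.
rewrite -(@ler_pXn2r _ 2) ?nnegrE ?addr_ge0//.
rewrite sqrrD !nE.
have bj j : `|b j 0| <= norm2 b.
  rewrite /norm2 -sqrtr_sqr ler_wsqrtr// (bigD1 j)//= lerDl sumr_ge0//.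
  by move=> i _; exact: sqr_ge0.
have zj j : `|z j 0| <= l1norm z.
  by rewrite /l1norm (bigD1 j)//= lerDl sumr_ge0.
have cross : \sum_(j < q) b j 0 * z j 0 <= norm2 b * l1norm z.
  rewrite /l1norm mulr_sumr; apply: ler_sum => j _.
  by apply: le_trans (ler_norm _) _; rewrite normrM ler_wpM2r.
have sq : \sum_(j < q) z j 0 ^+ 2 <= l1norm z ^+ 2.
  rewrite expr2 {1}/l1norm mulr_suml; apply: ler_sum => j _.
  by rewrite -real_normK ?num_real// expr2 ler_wpM2l.
under eq_bigr => j _ do rewrite mxE sqrrD.
rewrite !big_split/= -!addrA lerD2l lerD//.
by rewrite lerD.
Qed.

Lemma sqrt_gram (q p : nat) (C : 'M[R]_(q, p)) (u : 'cV[R]_p) :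
  Num.sqrt ((u^T *m C^T *m C *m u) 0 0) = norm2 (C *m u).
Proof.
rewrite -trmx_mul -mulmxA mxE /norm2; congr Num.sqrt; apply: eq_bigr => j _.
by rewrite mxE expr2.
Qed.

Lemma linform_dotv (q p : nat) (C : 'M[R]_(q, p)) (u : 'cV[R]_p) (y : 'cV[R]_q) :
  linform (C *m u) (fun j => y j 0) = dotv (C^T *m y) u.
Proof.
rewrite /dotv trmx_mul trmxK -mulmxA mxE; apply: eq_bigr => j _.
by rewrite [y^T _ _]mxE mulrC.
Qed.

Lemma mulmx_rowform (n q : nat) (B : 'M[R]_(n, q)) (v : 'cV[R]_q) i :
  (B *m v) i 0 = rowform i v (fun k => B k.1 k.2).
Proof. by rewrite mxE; apply: eq_bigr => j _; rewrite mulrC. Qed.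

Lemma l1normD (n : nat) (u v : 'cV[R]_n) : l1norm (u + v) <= l1norm u + l1norm v.
Proof. by rewrite -big_split/=; apply: ler_sum => i _; rewrite mxE ler_normD. Qed.

Lemma l1normN (n : nat) (u : 'cV[R]_n) : l1norm (- u) = l1norm u.
Proof. by apply: eq_bigr => i _; rewrite mxE normrN. Qed.

Lemma mx_norm_le_l1norm (n : nat) (u : 'cV[R]_n) : `|u| <= l1norm u.
Proof.
rewrite [leLHS]/Num.norm/= mx_normrE; apply: bigmax_le; first exact: sumr_ge0.
by move=> [i j] _; rewrite ord1 /l1norm (bigD1 i)//= lerDl sumr_ge0.
Qed.

Local Notation kap := (2 / Num.sqrt (2 * pi) : R).

(** At the net point [u'] the deviation is at most the maximum. Replacing [u] by [u'] moves [C *m u]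
    by at most [D] in l1 norm, which costs [kap * D] in the first term and [n%:R^-1 * abs_sum B * D]
    in the second. *)
Lemma net_bound (n q p : nat) (B : 'M[R]_(n, q)) (C : 'M[R]_(q, p)) (s : seq 'cV[R]_p)
    (delta eps : R) (u u' : 'cV[R]_p) : (0 < n)%N ->
  n%:R^-1 * l1norm (B *m (C *m u)) <= 2 * eps -> u' \in s -> `|u - u'| <= delta ->
  kap * norm2 (C *m u) <=
  n%:R^-1 * maxpos (map (mulmx C) s)
     (fun v => \sum_(i < n) (kap * norm2 v - `|rowform i v (fun k => B k.1 k.2)|)) +
  delta * (abs_sum C * (kap + n%:R^-1 * abs_sum B)) + 2 * eps.
Proof.
move=> n0 Bu us ud.
have kap0 : 0 <= kap by rewrite divr_ge0// sqrtr_ge0.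
move: kap kap0 => k kap0.
have nn : 0 < n%:R :> R by rewrite ltr0n.
pose z := C *m (u - u'); pose D := abs_sum C * delta.
have zD : l1norm z <= D.
  by apply: le_trans (mulmx_l1norm_le _ _) _; rewrite ler_wpM2l// abs_sum_ge0.
have nD : norm2 (C *m u) <= norm2 (C *m u') + D.
  rewrite -{1}(subrK u' u) addrC mulmxDr.
  by apply: le_trans (norm2_le_add_l1norm _ _) _; rewrite lerD2l.
have BD : l1norm (B *m (C *m u')) <= l1norm (B *m (C *m u)) + abs_sum B * D.
  have -> : C *m u' = C *m u - z by rewrite /z mulmxBr subKr.
  rewrite mulmxBr; apply: le_trans (l1normD _ _) _; rewrite l1normN lerD2l.
  apply: le_trans (mulmx_l1norm_le _ _) _; rewrite ler_wpM2l ?abs_sum_ge0//.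
  exact: le_trans (mx_norm_le_l1norm _) zD.
have := maxpos_ge (fun v => \sum_(i < n) (k * norm2 v - `|rowform i v (fun k => B k.1 k.2)|))
   (map_f (mulmx C) us).
set mp := maxpos _ _; rewrite sumrB sumr_const card_ord.
have -> : \sum_(i < n) `|rowform i (C *m u') (fun k => B k.1 k.2)| = l1norm (B *m (C *m u')).
  by apply: eq_bigr => i _; rewrite mulmx_rowform.
move=> H.
have {}H : k * norm2 (C *m u') <= n%:R^-1 * mp + n%:R^-1 * l1norm (B *m (C *m u')).
  by rewrite -mulrDr ler_pdivlMl// -lerBlDr [n%:R * _]mulr_natl.
have h1 := ler_wpM2l kap0 nD.
have nV : 0 <= (n%:R : R)^-1 by rewrite invr_ge0 ltW.
have h2 := ler_wpM2l nV BD.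
rewrite mulrDr in h1; rewrite mulrDr in h2.
have -> : delta * (abs_sum C * (k + n%:R^-1 * abs_sum B)) =
  k * D + n%:R^-1 * (abs_sum B * D) by rewrite /D; ring.
lra.
Qed.

Lemma integral_abs_sum (n q : nat) d (T : measurableType d) (P : probability T R)
    (B : T -> 'M[R]_(n, q)) :
  iid_std_gaussian P (fun k : 'I_n * 'I_q => fun w => B w k.1 k.2) ->
  measurable_fun setT (fun w => abs_sum (B w)) /\
  (\int[P]_w (abs_sum (B w))%:E = (\sum_(i < n) \sum_(j < q) kap)%:E)%E.
Proof.
move=> iB; have mB i j : measurable_fun setT (fun w => B w i j) by case: iB => /(_ (i, j)).
have mabs i j : measurable_fun setT (fun w => `|B w i j|) by apply: measurableT_comp.
have msum i : measurable_fun setT (fun w => \sum_(j < q) `|B w i j|) by exact: measurable_sum.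
split; first exact: measurable_sum.
rewrite /abs_sum; under eq_integral do rewrite -sumEFin.
rewrite ge0_integral_sum//; last 2 first.
- by move=> i; exact/measurable_EFinP.
- by move=> i w _; rewrite lee_fin sumr_ge0.
rewrite -sumEFin; apply: eq_bigr => i _.
under eq_integral do rewrite -sumEFin.
rewrite ge0_integral_sum//; last by move=> j; exact/measurable_EFinP.
rewrite -sumEFin; apply: eq_bigr => j _.
have mx : measurable_fun setT (fun x : R => `|x|%:E) by exact/measurable_EFinP.
by rewrite (iid_integral1 (i, j) iB mx)// normal_prob_abs_moment.
Qed.

End lipschitz.

(** * The recovery bound *)

Unset Implicit Arguments.

Theorem theorem7 (R : realType) (n q p : nat) (n_gt0 : (0 < n)%N)
  (d : measure_display) (T : measurableType d) (P : probability T R)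
  (B : T -> 'M[R]_(n, q))
  (HB : iid_std_gaussian P (fun k : 'I_n * 'I_q => fun w => B w k.1 k.2))
  (d' : measure_display) (T' : measurableType d') (P' : probability T' R)
  (g : T' -> 'cV[R]_q)
  (Hg : iid_std_gaussian P' (fun k : 'I_q => fun w => g w k 0))
  (C : 'M[R]_(q, p))
  (K : set 'cV[R]_p)
  (K_compact : compact K)
  (K_symm : forall x, K x -> K (- x))
  (K_convex : convex_set (K : set (convex_lmodType 'cV[R]_p)))
  (K_int : (interior K) !=set0)
  (eps : R) (eps_ge0 : 0 <= eps)
  (nu : T -> 'cV[R]_p -> 'cV[R]_n)
  (Hnu : forall w xs, K xs -> n%:R^-1 * l1norm (nu w xs) <= eps)
  (xhat : 'M[R]_(n, p) -> 'cV[R]_n -> 'cV[R]_p)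
  (Hxhat : forall (A : 'M[R]_(n, p)) (y : 'cV[R]_n),
     (exists x, n%:R^-1 * l1norm (A *m x - y) <= eps) ->
     n%:R^-1 * l1norm (A *m xhat A y - y) <= eps /\
     (forall x, n%:R^-1 * l1norm (A *m x - y) <= eps ->
        mink_functional K (xhat A y) <= mink_functional K x)) :
  (upper_expectation P (fun w =>
     ereal_sup [set (Num.sqrt
        (let A := B w *m C in
         let xs_hat := xhat A (A *m xs + nu w xs) in
         ((xs_hat - xs)^T *m C^T *m C *m (xs_hat - xs)) 0 0))%:E
       | xs in K])
   <= (Num.sqrt (2 * pi))%:E *
      ((\int[P']_w ereal_sup [set `| dotv (C^T *m g w) u |%:E | u in setDiff K])
         * (Num.sqrt n%:R)^-1%:E + eps%:E))%E.
Proof.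
have mB i j : measurable_fun setT (fun w => B w i j) by case: HB => /(_ (i, j)).
have [mA iA] := integral_abs_sum HB.
set c : R := Num.sqrt (2 * pi).
have c0 : 0 < c by rewrite sqrtr_gt0 mulr_gt0// pi_gt0.
have nn : 0 < n%:R :> R by rewrite ltr0n.
set W := (\int[P']_w _)%E.
have K0 : K 0 by exact: zero_mem.
have KK0 : setDiff K 0 by exists 0 => //; exists 0 => //; rewrite subrr.
have sup_ge0 w : (0 <= ereal_sup [set `|dotv (C^T *m g w) u|%:E | u in setDiff K])%E.
  by apply: ereal_sup_ge; exists `|dotv (C^T *m g w) 0|%:E; [exists 0|rewrite lee_fin].
have W0 : (0 <= W)%E by exact: integral_ge0.
(* The slack [e] will absorb the mean error of the net. *)
apply/lee_addgt0Pr => e e0.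
set kap : R := 2 / c.
have kap0 : 0 <= kap by rewrite divr_ge0// ltW.
(* [S] is the mean of [abs_sum (B w)], so [delta * M] is the mean net error; [delta] below makes
   [c / 2] times it at most [e], the added 1 keeping the denominator positive. *)
pose S : R := \sum_(i < n) \sum_(j < q) kap.
have S0 : 0 <= S by apply: sumr_ge0 => i _; exact: sumr_ge0.
pose M := abs_sum C * (kap + n%:R^-1 * S).
have M0 : 0 <= M by rewrite mulr_ge0 ?abs_sum_ge0// addr_ge0// mulr_ge0// invr_ge0 ltW.
pose delta := e / (c / 2 * M + 1).
have den0 : 0 < c / 2 * M + 1 by rewrite ltr_pwDr// mulr_ge0// divr_ge0// ltW.
have delta0 : 0 < delta by rewrite divr_gt0.
(* Mesh [delta / 2] in [K], so that differences of net points approximate [K - K] within [delta]. *)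
have [t tK tnet] := compact_finite_net K_compact (divr_gt0 delta0 (ltr0n _ 2)).
pose s := [seq u - v | u <- t, v <- t].
pose mp w := maxpos (map (mulmx C) s)
  (fun v => \sum_(i < n) (kap * norm2 v - `|rowform i v (fun k => B w k.1 k.2)|)).
have mmp : measurable_fun setT mp.
  apply: (@measurable_maxpos R _ _ T _ (fun v w => \sum_(i < n) (kap * norm2 v - `|rowform i v
      (fun k => B w k.1 k.2)|))) => v.
  apply: measurable_sum => i; apply: measurable_funB => //; apply: measurableT_comp => //.
  by apply: (measurable_linform v (X := fun j w => B w i j)).
(* The measurable majorant for the outer expectation: the bound of [net_bound] divided by
   [kap = 2 / c]. *)
pose h w : \bar R := ((c / 2) * (n%:R^-1 * mp w +
   delta * (abs_sum C * (kap + n%:R^-1 * abs_sum (B w))) + 2 * eps))%:E.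
have mh : measurable_fun setT h.
  apply/measurable_EFinP; apply: measurable_funM => //; apply: measurable_funD => //.
  apply: measurable_funD; first exact: measurable_funM.
  by do 2 apply: measurable_funM => //; apply: measurable_funD => //; exact: measurable_funM.
apply: (@le_trans _ _ (\int[P]_w h w)%E).
  apply: ereal_inf_lbound; exists h => //; split => // w.
  apply: ge_ereal_sup => _ [xs Kxs <-]; rewrite lee_fin.
  rewrite sqrt_gram; set A := B w *m C; set y := A *m xs + nu w xs.
  have feas : n%:R^-1 * l1norm (A *m xs - y) <= eps.
    by rewrite /y opprD addNKr l1normN; exact: Hnu.
  have [f1 f2] := Hxhat A y (ex_intro _ xs feas).
  (* The feasible point [xs] has functional at most 1, hence so does the minimizer. *)
  have Kx : K (xhat A y).
    apply: mem_of_mink_functional_le1 => //.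
    exact: le_trans (f2 _ feas) (mink_functional_le1 Kxs).
  have [u tu xu] := tnet _ Kx; have [v tv xv] := tnet _ Kxs.
  have near : `|xhat A y - xs - (u - v)| <= delta.
    rewrite (_ : _ - _ = (xhat A y - u) - (xs - v)); last first.
      by rewrite !opprB [v - u]addrC addrACA [- xs + v]addrC.
    apply: le_trans (ler_normB _ _) _; apply: ltW.
    by rewrite [ltRHS](splitr delta) ltrD.
  (* One [eps] comes from the constraint satisfied by the minimizer, the other from the noise. *)
  have res : n%:R^-1 * l1norm (B w *m (C *m (xhat A y - xs))) <= 2 * eps.
    have -> : B w *m (C *m (xhat A y - xs)) = (A *m xhat A y - y) + nu w xs.
      by rewrite mulmxA mulmxBr /y opprD addrA subrK.
    apply: (@le_trans _ _ (n%:R^-1 * (l1norm (A *m xhat A y - y) + l1norm (nu w xs)))).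
      by rewrite ler_wpM2l ?invr_ge0 ?(ltW nn)// l1normD.
    by rewrite mulrDr mulr_natl mulr2n lerD// Hnu.
  have us : u - v \in s by apply: allpairs_f.
  have := net_bound n_gt0 res us near.
  rewrite -/c -/kap -/(mp w) => H.
  by rewrite -ler_pdivrMl ?divr_gt0// invf_div.
have mp0 w : 0 <= mp w by exact: maxpos_ge0.
have sE : {in s, forall v, setDiff K v}.
  by move=> _ /allpairsP[[u v] /= [ut vt ->]]; exists u; [exact: tK|exists v => //; exact: tK].
(* The supremum over [K - K] dominates the finite maximum pointwise; [ge0_le_integralT] then
   compares the integrals without measurability of the supremum. *)
have mp_le : (\int[P]_w (mp w)%:E <= (2 * Num.sqrt n%:R)%:E * W)%E.
  apply: le_trans (gaussian_process_bound HB (map (mulmx C) s) n_gt0 Hg) _.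
  apply: lee_wpmul2l; first by rewrite lee_fin mulr_ge0// sqrtr_ge0.
  apply: ge0_le_integralT => w; first by rewrite lee_fin maxpos_ge0.
  apply: (@maxpos_attained _ _ _ _ (fun a => a%:E <= _)%E) => // _ /mapP[u us ->].
  rewrite linform_dotv; apply: ereal_sup_ge; exists `|dotv (C^T *m g w) u|%:E.
    by exists u => //; exact: sE.
  by rewrite lee_fin ler_norm.
have c20 : 0 <= c / 2 by rewrite divr_ge0// ltW.
have nV0 : 0 <= (n%:R : R)^-1 by rewrite invr_ge0 ltW.
have cn0 : 0 <= c / 2 * n%:R^-1 by rewrite mulr_ge0.
(* [h] is affine in [mp] and [abs_sum (B w)] with nonnegative coefficients, so its mean is computed
   term by term. *)
have hE : (\int[P]_w h w = (c / 2 * n%:R^-1)%:E * \int[P]_w (mp w)%:E +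
   (c / 2 * (delta * M + 2 * eps))%:E)%E.
  pose a := c / 2 * (delta * abs_sum C * n%:R^-1).
  pose b := c / 2 * (delta * abs_sum C * kap + 2 * eps).
  have dC0 : 0 <= delta * abs_sum C by rewrite mulr_ge0 ?abs_sum_ge0 ?(ltW delta0).
  have a0 : 0 <= a by rewrite mulr_ge0// mulr_ge0.
  have b0 : 0 <= b by rewrite mulr_ge0// addr_ge0// mulr_ge0.
  rewrite (_ : h = fun w => ((c / 2 * n%:R^-1)%:E * (mp w)%:E + (a%:E * (abs_sum (B w))%:E +
      b%:E))%E); last first.
    apply/funext => w; rewrite -!EFinM -!EFinD; congr EFin; rewrite /a /b; ring.
  have m1 : measurable_fun setT (fun w => (c / 2 * n%:R^-1)%:E * (mp w)%:E)%E.
    by apply: measurable_funeM; exact/measurable_EFinP.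
  have m2 : measurable_fun setT (fun w => a%:E * (abs_sum (B w))%:E)%E.
    by apply: measurable_funeM; exact/measurable_EFinP.
  rewrite ge0_integralD//=; last 3 first.
  - by move=> w _; rewrite -EFinM lee_fin mulr_ge0.
  - by move=> w _; rewrite -EFinM -EFinD lee_fin addr_ge0// mulr_ge0// abs_sum_ge0.
  - exact: emeasurable_funD.
  rewrite ge0_integralZl//=; last 2 first.
  - exact/measurable_EFinP.
  - by move=> w _; rewrite lee_fin.
  congr (_ + _)%E.
  rewrite ge0_integralD//=; last first.
    by move=> w _; rewrite -EFinM lee_fin mulr_ge0// abs_sum_ge0.
  rewrite ge0_integralZl//=; last 2 first.
  - exact/measurable_EFinP.
  - by move=> w _; rewrite lee_fin abs_sum_ge0.
  rewrite iA -/c -/kap -/S integral_cst//= probability_setT mule1 -EFinM -EFinD.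
  by congr EFin; rewrite /a /b /M; ring.
have dM : c / 2 * (delta * M) <= e.
  apply: (@le_trans _ _ (delta * (c / 2 * M + 1))).
    by rewrite mulrCA ler_wpM2l ?(ltW delta0)// lerDl.
  by rewrite /delta divfK// gt_eqF.
rewrite hE; apply: (@le_trans _ _ ((c / 2 * n%:R^-1)%:E * ((2 * Num.sqrt n%:R)%:E * W) +
   (c / 2 * (delta * M + 2 * eps))%:E)%E).
  by apply: leeD2r; apply: lee_wpmul2l => //; rewrite lee_fin mulr_ge0.
have sn0 : 0 < Num.sqrt (n%:R : R) by rewrite sqrtr_gt0.
have snE : n%:R = Num.sqrt (n%:R : R) ^+ 2 by rewrite sqr_sqrtr// ltW.
(* If [W] is infinite, so is the right-hand side; otherwise the claim is an inequality between
   reals. *)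
move: W0; case: W mp_le => [r| |] // _ W0; last first.
  rewrite [X in (_ <= X + _)%E](_ : _ = +oo)%E ?leey//.
  by rewrite gt0_mulye ?lte_fin ?invr_gt0// addye// gt0_muley ?lte_fin.
rewrite -!EFinM -!EFinD -?EFinM -?EFinD lee_fin.
(* The 2 from symmetrization cancels against [1 / kap = c / 2], as does the 2 in [2 * eps], leaving
   the constant [c]. *)
have -> : c / 2 * n%:R^-1 * (2 * Num.sqrt n%:R * r) = c * (r * (Num.sqrt n%:R)^-1).
  rewrite {1}snE; field; by rewrite gt_eqF.
rewrite mulrDr [c * (_ + eps)]mulrDr; lra.
Qed.
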